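(* Suppose that $H:T(M)\times_ME\to T(E)$ is a horizontal connection on a differential bundle $\mathsf{q}=(q:E\to M,+_q,0_q,\lambda)$ over $M$ in a tangent category. Let $f:X\to M$ be a map for which the pullback bundle $f^*(\mathsf{q})$ exists as a differential bundle, with pullback projections $f^*(q):f^*(E)\to X$ and $f^*_E:f^*(E)\to E$. Then $f^*H:T(X)\times_Xf^*(E)\to T(f^*(E))$, the unique map with $f^*H\,T(f^*_E)=(T(f)\times f^*_E)H$ and $f^*H\,T(f^*(q))=\pi_0$, is a horizontal connection on $f^*(\mathsf{q})$.
   Context: Conventions: composites are written in diagrammatic order ($fg$ means first $f$, then $g$). $\langle f,g\rangle$ is the induced map into a pullback, $\pi_0,\pi_1$ are projections, $h\times k=\langle\pi_0h,\pi_1k\rangle$ between pullbacks. Component subscripts of natural transformations are often omitted. An additive bundle over $M$ is a map $q:E\to M$ whose finite wide pullbacks $E_n$ along itself exist, with maps $+_q:E_2\to E$, $0_q:M\to E$ making $q$ a commutative monoid in the slice over $M$. An additive bundle morphism $(f_1,f_0)$ from $q:E\to M$ to $q':E'\to M'$ is a pair $f_1:E\to E'$, $f_0:M\to M'$ with $f_1q'=qf_0$ preserving addition and zero. A tangent category is a category with a functor $T$ and natural transformations $p:T\to 1$, $0:1\to T$, $+:T_2\to T$, $\ell:T\to T^2$, $c:T^2\to T^2$ such that: each $(p_M,+_M,0_M)$ is an additive bundle, the wide pullbacks $T_nM$ of $p_M$ exist and are preserved by each $T^k$; $(\ell_M,0_M)$ is an additive bundle morphism from $(p_M,+_M,0_M)$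 to $(T(p_M),T(+_M),T(0_M))$; $(c_M,1)$ is an additive bundle morphism from $(T(p_M),T(+_M),T(0_M))$ to $(p_{TM},+_{TM},0_{TM})$; $c^2=1$, $\ell c=\ell$, $\ell_M\ell_{TM}=\ell_MT(\ell_M)$, $T(c)cT(c)=cT(c)c$, $\ell_{TM}T(c_M)c_{TM}=c_MT(\ell_M)$; and the square with top $\langle\pi_0\ell,\pi_10\rangle T(+):T_2M\to T^2M$, left $\pi_0p=\pi_1p$, right $T(p)$, bottom $0_M$ is a pullback preserved by each $T^k$. A differential bundle $\mathsf{q}=(q:E\to M,+_q,0_q,\lambda)$ is an additive bundle with a lift $\lambda:E\to T(E)$ such that: the wide pullbacks $E_n$ are preserved by each $T^k$; for all $n,m$ the pullback of $E_n\to M$ along $T_mM\to M$ exists and is preserved by each $T^k$; $(\lambda,0_M)$ is an additive bundle morphism from $q$ to $(T(q),T(+_q),T(0_q))$; $(\lambda,0_q)$ is an additive bundle morphism from $q$ to $(p_E,+_E,0_E)$; with $\mu:=\langle\pi_0\lambda,\pi_10\rangle T(+_q):E_2\to T(E)$, the square with top $\mu$, left $\pi_0q=\pi_1q:E_2\to M$, right $T(q)$, bottom $0_M$ is a pullback (preserved by each $T^k$); and $\lambda\ell_E=\lambda T(\lambda)$. Pullback bundle: for $f:X\to M$, if the pullback $f^*(E)$ of $q$ along $f$ exists and is preserved by each $T^k$, and the further pullbacks required by the definition of differential bundle exist and are preserved, then $f^*(\mathsf{q})$ is $f^*(q):f^*(E)\to X$ with induced addition and zero and lift $f^*(\lambda)$,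 the unique map $f^*(E)\to T(f^*(E))$ with $f^*(\lambda)T(f^*_E)=f^*_E\lambda$ and $f^*(\lambda)T(f^*(q))=f^*(q)0_X$; it is a differential bundle. A horizontal connection on a differential bundle $\mathsf{q}$ is a map $H:T(M)\times_ME\to T(E)$ (pullback of $p_M$ and $q$, $\pi_0$ to $T(M)$, $\pi_1$ to $E$) with $HT(q)=\pi_0$, $Hp=\pi_1$, $H\ell=(\ell\times0)T(H)$ and $HT(\lambda)c=(0\times\lambda)T(H)$. *)

(* Defs.v *)
From mathcomp Require Import ssreflect ssrfun ssrbool eqtype ssrnat fintype.

Set Implicit Arguments.
Unset Strict Implicit.
Unset Printing Implicit Defensive.

Declare Scope cat_scope.
Delimit Scope cat_scope with cat.
Local Open Scope cat_scope.

(** * Categories, functors, natural transformations *)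

Record category := Category {
  obj :> Type;
  hom : obj -> obj -> Type;
  idm : forall A, hom A A;
  compm : forall A B D, hom A B -> hom B D -> hom A D;
  compm1l : forall A B (f : hom A B), compm (idm A) f = f;
  compm1r : forall A B (f : hom A B), compm f (idm B) = f;
  compmA : forall A B D G (f : hom A B) (g : hom B D) (h : hom D G),
    compm f (compm g h) = compm (compm f g) h
}.

Arguments hom {c} A B.
Arguments idm {c} A.
Arguments compm {c A B D} f g.

(* Diagrammatic order: [f \; g] is first [f], then [g]. *)
Notation "f \; g" := (compm f g) : cat_scope.

Record functor (C D : category) := Functor {
  fob :> C -> D;
  fmap : forall A B : C, hom A B -> hom (fob A) (fob B);
  fmap1 : forall A, fmap (idm A) = idm (fob A);
  fmapM : forall A B G (f : hom A B) (g : hom B G),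
    fmap (f \; g) = fmap f \; fmap g
}.

Arguments fmap {C D} F {A B} f : rename.

Definition fid (C : category) : functor C C :=
  @Functor C C (fun A => A) (fun A B f => f)
    (fun A => erefl) (fun A B G f g => erefl).

Definition fcomp (C D G : category) (F1 : functor C D) (F2 : functor D G) :
  functor C G.
Proof.
refine (@Functor C G (fun A => F2 (F1 A)) (fun A B f => fmap F2 (fmap F1 f)) _ _).
- by move=> A; rewrite !fmap1.
- by move=> A B L f g; rewrite !fmapM.
Defined.

Fixpoint fiter (C : category) (F : functor C C) (k : nat) : functor C C :=
  if k is k'.+1 then fcomp (fiter F k') F else fid C.

Record nat_trans (C D : category) (F G : functor C D) := NatTrans {
  nt :> forall A : C, hom (F A) (G A);
  nt_nat : forall (A B : C) (f : hom A B), fmap F f \; nt B = nt A \; fmap G f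
}.

(** * Pullbacks *)

(* The mediating maps are given as an operation. They are unique, so this
   carries no more information than their existence, and "the" induced map
   can be named without a choice axiom. *)
Record is_pullback (C : category) (A B D P : C) (f : hom A D) (g : hom B D)
    (u : hom P A) (v : hom P B) : Type := IsPullback {
  ipb_comm : u \; f = v \; g;
  ipb_pair : forall (Z : C) (a : hom Z A) (b : hom Z B),
    a \; f = b \; g -> hom Z P;
  ipb_pair0 : forall Z a b (e : a \; f = b \; g), @ipb_pair Z a b e \; u = a;
  ipb_pair1 : forall Z a b (e : a \; f = b \; g), @ipb_pair Z a b e \; v = b;
  ipb_uniq : forall (Z : C) (h k : hom Z P),
    h \; u = k \; u -> h \; v = k \; v -> h = k
}.

Record pullback (C : category) (A B D : C) (f : hom A D) (g : hom B D) :=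
  Pullback {
  pb_obj :> C;
  pb0 : hom pb_obj A;
  pb1 : hom pb_obj B;
  pb_is : is_pullback f g pb0 pb1
}.

Definition preserves_pb (C : category) (A B D : C) (f : hom A D) (g : hom B D)
    (F : functor C C) (P : pullback f g) : Type :=
  is_pullback (fmap F f) (fmap F g) (fmap F (pb0 P)) (fmap F (pb1 P)).

Definition map_pb (C : category) (A B D : C) (f : hom A D) (g : hom B D)
    (F : functor C C) (P : pullback f g) (pres : preserves_pb F P) :
  pullback (fmap F f) (fmap F g) := Pullback pres.

Lemma pb_times_subproof (C : category) (A B D A' B' D' : C)
    (f : hom A D) (g : hom B D) (f' : hom A' D') (g' : hom B' D')
    (P : pullback f g) (h : hom A A') (k : hom B B') (m : hom D D')
    (eh : h \; f' = f \; m) (ek : k \; g' = g \; m) :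
  (pb0 P \; h) \; f' = (pb1 P \; k) \; g'.
Proof. by rewrite -!compmA eh ek !compmA (ipb_comm (pb_is P)). Qed.

(* [h x k = <pi0 h, pi1 k>] between the pullbacks [P] and [P'], where [h] and
   [k] lie over the same map [m] of base objects. *)
Definition pb_times (C : category) (A B D A' B' D' : C)
    (f : hom A D) (g : hom B D) (f' : hom A' D') (g' : hom B' D')
    (P : pullback f g) (P' : pullback f' g')
    (h : hom A A') (k : hom B B') (m : hom D D')
    (eh : h \; f' = f \; m) (ek : k \; g' = g \; m) : hom P P' :=
  ipb_pair (pb_is P') (pb_times_subproof P eh ek).

(** * Finite wide pullbacks of a map along itself *)

Record is_wide_pullback (C : category) (E M : C) (q : hom E M) (n : nat)
    (P : C) (b : hom P M) (pr : 'I_n -> hom P E) : Type := IsWidePullback {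
  iwp_comm : forall i, pr i \; q = b;
  iwp_pair : forall (Z : C) (z : hom Z M) (e : 'I_n -> hom Z E),
    (forall i, e i \; q = z) -> hom Z P;
  iwp_pair_base : forall Z z e (he : forall i, e i \; q = z),
    @iwp_pair Z z e he \; b = z;
  iwp_pair_proj : forall Z z e (he : forall i, e i \; q = z) i,
    @iwp_pair Z z e he \; pr i = e i;
  iwp_uniq : forall (Z : C) (h k : hom Z P),
    h \; b = k \; b -> (forall i, h \; pr i = k \; pr i) -> h = k
}.

Record wide_pullback (C : category) (E M : C) (q : hom E M) (n : nat) :=
  WidePullback {
  wp_obj :> C;
  wp_base : hom wp_obj M;
  wp_proj : 'I_n -> hom wp_obj E;
  wp_is : is_wide_pullback q wp_base wp_proj
}.

Definition preserves_wp (C : category) (E M : C) (q : hom E M) (n : nat)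
    (F : functor C C) (P : wide_pullback q n) : Type :=
  is_wide_pullback (fmap F q) (fmap F (wp_base P)) (fun i => fmap F (wp_proj P i)).

Definition map_wp (C : category) (E M : C) (q : hom E M) (n : nat)
    (F : functor C C) (P : wide_pullback q n) (pres : preserves_wp F P) :
  wide_pullback (fmap F q) n := WidePullback pres.

(* [E] itself is a 1-fold wide pullback of [q : E -> M]. *)
Definition wp_one (C : category) (E M : C) (q : hom E M) : wide_pullback q 1.
Proof.
refine (@WidePullback C E M q 1 E q (fun=> idm E)
  (@IsWidePullback C E M q 1 E q (fun=> idm E) _ (fun Z z e _ => e ord0) _ _ _)).
- by move=> _; rewrite compm1l.
- by move=> Z z e he; apply: he.
- by move=> Z z e he i; rewrite compm1r (ord1 i).
- by move=> Z h k _ /(_ ord0); rewrite !compm1r.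
Defined.

Lemma wp_pair2_subproof (C : category) (E M : C) (q : hom E M)
    (Z : C) (z : hom Z M) (a b : hom Z E) (ea : a \; q = z) (eb : b \; q = z)
    (i : 'I_2) : (if val i is 0 then a else b) \; q = z.
Proof. by case: (val i). Qed.

(* [<a, b> : Z -> E_2], for [a] and [b] lying over the same [z : Z -> M]. *)
Definition wp_pair2 (C : category) (E M : C) (q : hom E M)
    (P : wide_pullback q 2) (Z : C) (z : hom Z M) (a b : hom Z E)
    (ea : a \; q = z) (eb : b \; q = z) : hom Z P :=
  iwp_pair (wp_is P) (wp_pair2_subproof ea eb).

Definition i20 : 'I_2 := @Ordinal 2 0 isT.
Definition i21 : 'I_2 := @Ordinal 2 1 isT.
Definition i30 : 'I_3 := @Ordinal 3 0 isT.
Definition i31 : 'I_3 := @Ordinal 3 1 isT.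
Definition i32 : 'I_3 := @Ordinal 3 2 isT.

Lemma wp_times_subproof (C : category) (E M E' M' : C)
    (q : hom E M) (q' : hom E' M') (P : wide_pullback q 2) (i : 'I_2)
    (h : hom E E') (m : hom M M') (eh : h \; q' = q \; m) :
  (wp_proj P i \; h) \; q' = wp_base P \; m.
Proof. by rewrite -compmA eh compmA (iwp_comm (wp_is P)). Qed.

(* [<pi0 h, pi1 k> : E_2 -> E'_2], where [h] and [k] lie over [m : M -> M']. *)
Definition wp_times (C : category) (E M E' M' : C)
    (q : hom E M) (q' : hom E' M')
    (P : wide_pullback q 2) (P' : wide_pullback q' 2)
    (h k : hom E E') (m : hom M M')
    (eh : h \; q' = q \; m) (ek : k \; q' = q \; m) : hom P P' :=
  wp_pair2 P' (wp_times_subproof P i20 eh) (wp_times_subproof P i21 ek).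

(** * Additive bundles *)

Record add_ops (C : category) (E M : C) (q : hom E M) := AddOps {
  ao_pow : forall n, wide_pullback q n;
  ao_add : hom (ao_pow 2) E;
  ao_zero : hom M E;
  ao_add_over : ao_add \; q = wp_base (ao_pow 2);
  ao_zero_over : ao_zero \; q = idm M
}.

Section Sum.
Variables (C : category) (E M : C) (q : hom E M) (A : add_ops q).

(* [<a, b> +_q] *)
Definition ao_sum (Z : C) (z : hom Z M) (a b : hom Z E)
    (ea : a \; q = z) (eb : b \; q = z) : hom Z E :=
  wp_pair2 (ao_pow A 2) ea eb \; ao_add A.

Lemma ao_sum_over (Z : C) (z : hom Z M) (a b : hom Z E)
    (ea : a \; q = z) (eb : b \; q = z) : ao_sum ea eb \; q = z.
Proof. by rewrite -compmA ao_add_over (iwp_pair_base (wp_is _)). Qed.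

Lemma ao_proj_over n (i : 'I_n) :
  wp_proj (ao_pow A n) i \; q = wp_base (ao_pow A n).
Proof. exact: (iwp_comm (wp_is _)). Qed.

Lemma ao_zero_elt_over : (q \; ao_zero A) \; q = q.
Proof. by rewrite -compmA ao_zero_over compm1r. Qed.

End Sum.

(* A commutative monoid in the slice over [M]. *)
Record additive_bundle (C : category) (E M : C) (q : hom E M) := AdditiveBundle {
  ab_ops :> add_ops q;
  ab_assoc : let pr := @ao_proj_over C E M q ab_ops 3 in
    ao_sum ab_ops (ao_sum_over ab_ops (pr i30) (pr i31)) (pr i32)
    = ao_sum ab_ops (pr i30) (ao_sum_over ab_ops (pr i31) (pr i32));
  ab_comm : let pr := @ao_proj_over C E M q ab_ops 2 in
    ao_sum ab_ops (pr i20) (pr i21) = ao_sum ab_ops (pr i21) (pr i20);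
  ab_unit : ao_sum ab_ops (ao_zero_elt_over ab_ops) (compm1l q) = idm E
}.

Record is_add_morphism (C : category) (E M E' M' : C)
    (q : hom E M) (q' : hom E' M') (A : add_ops q) (A' : add_ops q')
    (f1 : hom E E') (f0 : hom M M') : Prop := IsAddMorphism {
  am_sq : f1 \; q' = q \; f0;
  am_add : ao_add A \; f1
    = wp_times (ao_pow A 2) (ao_pow A' 2) am_sq am_sq \; ao_add A';
  am_zero : ao_zero A \; f1 = f0 \; ao_zero A'
}.

(* [(F(q), F(+_q), F(0_q))], for a functor [F] preserving the [E_n]. *)
Definition map_ao (C : category) (E M : C) (q : hom E M) (A : add_ops q)
    (F : functor C C) (pres : forall n, preserves_wp F (ao_pow A n)) :
  add_ops (fmap F q).
Proof.
refine (@AddOps C (F E) (F M) (fmap F q) (fun n => map_wp (pres n))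
  (fmap F (ao_add A)) (fmap F (ao_zero A)) _ _).
- by rewrite -fmapM ao_add_over.
- by rewrite -fmapM ao_zero_over fmap1.
Defined.

(** * Tangent categories *)

(* [<pi0 l, pi1 z> F(+_q) : E_2 -> F(E)] *)
Definition lift_sum (C : category) (E M : C) (q : hom E M) (A : add_ops q)
    (F : functor C C) (pres : forall n, preserves_wp F (ao_pow A n))
    (l z : hom E (F E)) (z0 : hom M (F M))
    (el : l \; fmap F q = q \; z0) (ez : z \; fmap F q = q \; z0) :
  hom (ao_pow A 2) (F E) :=
  wp_times (ao_pow A 2) (map_wp (pres 2)) el ez \; fmap F (ao_add A).

(* [fiter tT 0] and [fiter tT 1] are convertible to the identity and to [tT]:
   in each preservation clause, [k = 0] is the unpreserved statement. *)
Record tangent_structure (C : category) := TangentStructure {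
  tT : functor C C;
  tp : nat_trans tT (fid C);
  tbundle : forall M : C, additive_bundle (tp M);
  tpow_pres : forall (M : C) (n k : nat),
    preserves_wp (fiter tT k) (ao_pow (tbundle M) n);
  tzero_nat : forall (M N : C) (f : hom M N),
    ao_zero (tbundle M) \; fmap tT f = f \; ao_zero (tbundle N);
  tplus_nat : forall (M N : C) (f : hom M N),
    ao_add (tbundle M) \; fmap tT f
    = wp_times (ao_pow (tbundle M) 2) (ao_pow (tbundle N) 2)
        (nt_nat tp f) (nt_nat tp f) \; ao_add (tbundle N);
  tell : nat_trans tT (fcomp tT tT);
  tc : nat_trans (fcomp tT tT) (fcomp tT tT);
  tell_add : forall M : C,
    is_add_morphism (tbundle M) (@map_ao _ _ _ _ (tbundle M) tT (tpow_pres M ^~ 1))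
      (tell M) (ao_zero (tbundle M));
  tc_add : forall M : C,
    is_add_morphism (@map_ao _ _ _ _ (tbundle M) tT (tpow_pres M ^~ 1))
      (tbundle (tT M)) (tc M) (idm (tT M));
  tcc : forall M : C, tc M \; tc M = idm (tT (tT M));
  tellc : forall M : C, tell M \; tc M = tell M;
  tellell : forall M : C, tell M \; tell (tT M) = tell M \; fmap tT (tell M);
  tccc : forall M : C,
    fmap tT (tc M) \; (tc (tT M) \; fmap tT (tc M))
    = tc (tT M) \; (fmap tT (tc M) \; tc (tT M));
  tellcc : forall M : C,
    tell (tT M) \; (fmap tT (tc M) \; tc (tT M)) = tc M \; fmap tT (tell M);
  tuniv : forall (M : C) (k : nat),
    is_pullback
      (fmap (fiter tT k) (ao_zero (tbundle M)))
      (fmap (fiter tT k) (fmap tT (tp M)))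
      (fmap (fiter tT k) (wp_base (ao_pow (tbundle M) 2)))
      (fmap (fiter tT k)
        (@lift_sum _ _ _ _ (tbundle M) tT (tpow_pres M ^~ 1)
          (tell M) (ao_zero (tbundle (tT M))) (ao_zero (tbundle M))
          (am_sq (tell_add M)) (tzero_nat (tp M))))
}.

Definition tzero (C : category) (TC : tangent_structure C) (M : C) :
  hom M (tT TC M) := ao_zero (tbundle TC M).

(* A pullback preserved by each [T^k]. *)
Record tpullback (C : category) (TC : tangent_structure C) (A B D : C)
    (f : hom A D) (g : hom B D) := TPullback {
  tpb :> pullback f g;
  tpb_pres : forall k, preserves_pb (fiter (tT TC) k) tpb
}.

(* [T(A x_D B)] as the pullback of [T(f)] and [T(g)] *)
Definition tpb_T (C : category) (TC : tangent_structure C) (A B D : C)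
    (f : hom A D) (g : hom B D) (P : tpullback TC f g) :
  pullback (fmap (tT TC) f) (fmap (tT TC) g) :=
  @map_pb _ _ _ _ _ _ (tT TC) P (tpb_pres P 1).

(** * Differential bundles *)

(* [E_n] and [T_m M] are determined up to isomorphism only; [db_fib] is stated
   for all choices of them, so that it applies to [E_1 = E] and [T_1 M = TM]. *)
Record differential_bundle (C : category) (TC : tangent_structure C) (E M : C)
    (q : hom E M) := DifferentialBundle {
  db_add :> additive_bundle q;
  db_lift : hom E (tT TC E);
  db_pow_pres : forall n k : nat,
    preserves_wp (fiter (tT TC) k) (ao_pow db_add n);
  db_fib : forall (n m : nat) (En : wide_pullback q n)
      (TmM : wide_pullback (tp TC M) m),
    tpullback TC (wp_base TmM) (wp_base En);
  db_lift_T : is_add_morphism db_add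
    (@map_ao _ _ _ _ db_add (tT TC) (db_pow_pres ^~ 1)) db_lift (tzero TC M);
  db_lift_p : is_add_morphism db_add (tbundle TC E) db_lift (ao_zero db_add);
  db_univ : forall k : nat,
    is_pullback
      (fmap (fiter (tT TC) k) (tzero TC M))
      (fmap (fiter (tT TC) k) (fmap (tT TC) q))
      (fmap (fiter (tT TC) k) (wp_base (ao_pow db_add 2)))
      (fmap (fiter (tT TC) k)
        (@lift_sum _ _ _ _ db_add (tT TC) (db_pow_pres ^~ 1)
          db_lift (tzero TC E) (tzero TC M)
          (am_sq db_lift_T) (tzero_nat TC q)));
  db_lift_ell : db_lift \; tell TC E = db_lift \; fmap (tT TC) db_lift
}.

(* The addition and zero of [f^*(q)] are the maps over [X] induced by those of
   [q], i.e. those making [(f^*_E, f)] an additive bundle morphism. *)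
Record is_pullback_bundle (C : category) (TC : tangent_structure C)
    (E M X : C) (q : hom E M) (Q : differential_bundle TC q) (f : hom X M)
    (P : tpullback TC f q) (fQ : differential_bundle TC (pb0 P)) : Prop :=
  IsPullbackBundle {
  ipbb_add : is_add_morphism fQ Q (pb1 P) f;
  ipbb_lift1 : db_lift fQ \; fmap (tT TC) (pb1 P) = pb1 P \; db_lift Q;
  ipbb_lift0 : db_lift fQ \; fmap (tT TC) (pb0 P) = pb0 P \; tzero TC X
}.

(** * Horizontal connections *)

(* [T(M) x_M E], with [pb0] to [T(M)] and [pb1] to [E] *)
Definition db_TxE (C : category) (TC : tangent_structure C) (E M : C)
    (q : hom E M) (Q : differential_bundle TC q) : tpullback TC (tp TC M) q :=
  db_fib Q (wp_one q) (wp_one (tp TC M)).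

Record is_horizontal_connection (C : category) (TC : tangent_structure C)
    (E M : C) (q : hom E M) (Q : differential_bundle TC q)
    (H : hom (db_TxE Q) (tT TC E)) : Prop := IsHorizontalConnection {
  hc_q : H \; fmap (tT TC) q = pb0 (db_TxE Q);
  hc_p : H \; tp TC E = pb1 (db_TxE Q);
  hc_ell : H \; tell TC E
    = pb_times (db_TxE Q) (tpb_T (db_TxE Q))
        (am_sq (tell_add TC M)) (tzero_nat TC q) \; fmap (tT TC) H;
  hc_lift : H \; (fmap (tT TC) (db_lift Q) \; tc TC E)
    = pb_times (db_TxE Q) (tpb_T (db_TxE Q))
        (tzero_nat TC (tp TC M)) (am_sq (db_lift_T Q)) \; fmap (tT TC) H
}.

(* [T(f) x f^*_E : T(X) x_X f^*(E) -> T(M) x_M E] *)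
Definition TfxfE (C : category) (TC : tangent_structure C)
    (E M X : C) (q : hom E M) (Q : differential_bundle TC q) (f : hom X M)
    (P : tpullback TC f q) (fQ : differential_bundle TC (pb0 P)) :
  hom (db_TxE fQ) (db_TxE Q) :=
  pb_times (db_TxE fQ) (db_TxE Q)
    (nt_nat (tp TC) f) (esym (ipb_comm (pb_is P))).

(* Main.v *)
Require Import Defs.
From mathcomp Require Import ssreflect ssrfun.

Local Open Scope cat_scope.

(** A map into a pullback is determined by its two components. As [f^*(E)] is
    a pullback of [f] and [q] preserved by [T] and [T^2], the map [f^*H]
    exists uniquely, and each of the four connection axioms for it can be
    tested after composing with [f^*(q)] and with [f^*_E], or with their images
    under [T] or [T^2].

    - Along [f^*(q)] an axiom only involves the component in [T(X)], on which
      [f^*H] is the projection. What remains is naturality of [p], [l] and [c]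
      and, for the axiom on the lift, the fact that the lift of [f^*(q)] lies
      over [0], combined with [T(0)c = 0].
    - Along [f^*_E] naturality turns the axiom for [f^*H] into [T(f) x f^*_E]
      followed by the axiom for [H]. It remains to slide [T(f) x f^*_E] past
      [l x 0] and past [0 x lambda] ([TfxfE_natural]); this is naturality of
      [l] and [0] together with the fact that [f^*_E] commutes with the
      lifts. *)

Set Implicit Arguments.
Unset Strict Implicit.
Unset Printing Implicit Defensive.

Section PbTimes.
Variables (C : category) (A B D A' B' D' : C).
Variables (f : hom A D) (g : hom B D) (f' : hom A' D') (g' : hom B' D').
Variables (P : pullback f g) (P' : pullback f' g').
Variables (h : hom A A') (k : hom B B') (m : hom D D').
Variables (eh : h \; f' = f \; m) (ek : k \; g' = g \; m).

Lemma pb_times0 : pb_times P P' eh ek \; pb0 P' = pb0 P \; h.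
Proof. exact: ipb_pair0. Qed.

Lemma pb_times1 : pb_times P P' eh ek \; pb1 P' = pb1 P \; k.
Proof. exact: ipb_pair1. Qed.

End PbTimes.

Section TangentPullback.
Variables (C : category) (TC : tangent_structure C) (A B D : C).
Variables (f : hom A D) (g : hom B D) (P : tpullback TC f g).

Lemma tpb_ext (Z : C) (h k : hom Z P) :
  h \; pb0 P = k \; pb0 P -> h \; pb1 P = k \; pb1 P -> h = k.
Proof. exact: (ipb_uniq (pb_is P)). Qed.

Lemma tpb_ext_T (Z : C) (h k : hom Z (tT TC P)) :
  h \; fmap (tT TC) (pb0 P) = k \; fmap (tT TC) (pb0 P) ->
  h \; fmap (tT TC) (pb1 P) = k \; fmap (tT TC) (pb1 P) -> h = k.
Proof. exact: (ipb_uniq (tpb_pres P 1)). Qed.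

Lemma tpb_ext_TT (Z : C) (h k : hom Z (tT TC (tT TC P))) :
  h \; fmap (tT TC) (fmap (tT TC) (pb0 P))
    = k \; fmap (tT TC) (fmap (tT TC) (pb0 P)) ->
  h \; fmap (tT TC) (fmap (tT TC) (pb1 P))
    = k \; fmap (tT TC) (fmap (tT TC) (pb1 P)) -> h = k.
Proof. exact: (ipb_uniq (tpb_pres P 2)). Qed.

End TangentPullback.

Section NaturalityEquations.
Variables (C : category) (TC : tangent_structure C).
Local Notation T := (tT TC).

Lemma tell_natural (M N : C) (f : hom M N) :
  tell TC M \; fmap T (fmap T f) = fmap T f \; tell TC N.
Proof. by rewrite (nt_nat (tell TC) f). Qed.

Lemma tc_natural (M N : C) (f : hom M N) :
  tc TC M \; fmap T (fmap T f) = fmap T (fmap T f) \; tc TC N.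
Proof. exact: esym (nt_nat (tc TC) f). Qed.

Lemma tp_natural (M N : C) (f : hom M N) :
  fmap T f \; tp TC N = tp TC M \; f.
Proof. exact: (nt_nat (tp TC) f). Qed.

Lemma tzero_natural (M N : C) (f : hom M N) :
  tzero TC M \; fmap T f = f \; tzero TC N.
Proof. exact: tzero_nat. Qed.

(** The flip exchanges the two bundle structures on [T^2(M)], hence their
    zeros. *)
Lemma fmap_tzero_tc (M : C) :
  fmap T (tzero TC M) \; tc TC M = tzero TC (T M).
Proof. by have := am_zero (tc_add TC M); rewrite /= compm1l. Qed.

End NaturalityEquations.

Section PullbackConnection.
Variables (C : category) (TC : tangent_structure C).
Variables (E M X : C) (q : hom E M) (Q : differential_bundle TC q).
Variables (f : hom X M) (P : tpullback TC f q).
Variables (fQ : differential_bundle TC (pb0 P)).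
Local Notation T := (tT TC).

Lemma TfxfE0 : TfxfE Q fQ \; pb0 (db_TxE Q) = pb0 (db_TxE fQ) \; fmap T f.
Proof. exact: pb_times0. Qed.

Lemma TfxfE1 : TfxfE Q fQ \; pb1 (db_TxE Q) = pb1 (db_TxE fQ) \; pb1 P.
Proof. exact: pb_times1. Qed.

(** Sliding [T(f) x f^*_E] past a product map only requires each factor to
    commute with its own component. The instances used are [l x 0] and
    [0 x lambda], where the second factor is natural in the first case and
    commutes with [f^*_E] by the definition of the pullback lift in the
    second. *)
Lemma TfxfE_natural (h : hom (T M) (T (T M))) (k : hom E (T E))
    (m : hom M (T M)) (h' : hom (T X) (T (T X))) (k' : hom P (T P))
    (m' : hom X (T X))
    (eh : h \; fmap T (tp TC M) = tp TC M \; m)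
    (ek : k \; fmap T q = q \; m)
    (eh' : h' \; fmap T (tp TC X) = tp TC X \; m')
    (ek' : k' \; fmap T (pb0 P) = pb0 P \; m') :
  h' \; fmap T (fmap T f) = fmap T f \; h ->
  k' \; fmap T (pb1 P) = pb1 P \; k ->
  TfxfE Q fQ \; pb_times (db_TxE Q) (tpb_T (db_TxE Q)) eh ek
  = pb_times (db_TxE fQ) (tpb_T (db_TxE fQ)) eh' ek' \; fmap T (TfxfE Q fQ).
Proof.
move=> hh kk; apply: (tpb_ext_T (P := db_TxE Q)).
- rewrite -!compmA -fmapM TfxfE0 fmapM (pb_times0 _ (tpb_T (db_TxE Q))).
  rewrite [RHS]compmA (pb_times0 _ (tpb_T (db_TxE fQ))).
  by rewrite compmA TfxfE0 -!compmA hh.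
- rewrite -!compmA -fmapM TfxfE1 fmapM (pb_times1 _ (tpb_T (db_TxE Q))).
  rewrite [RHS]compmA (pb_times1 _ (tpb_T (db_TxE fQ))).
  by rewrite compmA TfxfE1 -!compmA kk.
Qed.

Variables (H : hom (db_TxE Q) (T E)) (hH : is_horizontal_connection H).

Lemma pullback_connection_compat :
  pb0 (db_TxE fQ) \; fmap T f = (TfxfE Q fQ \; H) \; fmap T q.
Proof. by rewrite -compmA (hc_q hH) TfxfE0. Qed.

Definition pullback_connection : hom (db_TxE fQ) (T P) :=
  ipb_pair (pb_is (tpb_T P)) pullback_connection_compat.

Local Notation fH := pullback_connection.

Lemma pullback_connection0 : fH \; fmap T (pb0 P) = pb0 (db_TxE fQ).
Proof. exact: (ipb_pair0 (pb_is (tpb_T P))). Qed.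

Lemma pullback_connection1 : fH \; fmap T (pb1 P) = TfxfE Q fQ \; H.
Proof. exact: (ipb_pair1 (pb_is (tpb_T P))). Qed.

Lemma pullback_connection_p : fH \; tp TC P = pb1 (db_TxE fQ).
Proof.
apply: tpb_ext.
- rewrite -compmA -tp_natural compmA pullback_connection0.
  exact: (ipb_comm (pb_is (db_TxE fQ))).
- by rewrite -compmA -tp_natural compmA pullback_connection1 -compmA (hc_p hH)
             TfxfE1.
Qed.

Lemma pullback_connection_ell :
  fH \; tell TC P
  = pb_times (db_TxE fQ) (tpb_T (db_TxE fQ))
      (am_sq (tell_add TC X)) (tzero_nat TC (pb0 P)) \; fmap T fH.
Proof.
apply: tpb_ext_TT.
- rewrite -!compmA tell_natural -fmapM compmA pullback_connection0.
  by rewrite (pb_times0 _ (tpb_T (db_TxE fQ))).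
- rewrite -!compmA tell_natural -fmapM compmA pullback_connection1 fmapM.
  rewrite -compmA (hc_ell hH) !compmA; congr (_ \; _).
  by apply: TfxfE_natural; [exact: tell_natural | exact: tzero_natural].
Qed.

Hypothesis hfQ : is_pullback_bundle Q fQ.

Lemma pullback_connection_lift :
  fH \; (fmap T (db_lift fQ) \; tc TC P)
  = pb_times (db_TxE fQ) (tpb_T (db_TxE fQ))
      (tzero_nat TC (tp TC X)) (am_sq (db_lift_T fQ)) \; fmap T fH.
Proof.
apply: tpb_ext_TT.
- rewrite -!compmA tc_natural -fmapM pullback_connection0.
  rewrite (pb_times0 _ (tpb_T (db_TxE fQ))).
  rewrite (compmA (fmap T (db_lift fQ))) -fmapM (ipbb_lift0 hfQ) fmapM.
  by rewrite -compmA fmap_tzero_tc compmA pullback_connection0.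
- rewrite -!compmA tc_natural -fmapM pullback_connection1 fmapM.
  rewrite (compmA (fmap T (db_lift fQ))) -fmapM (ipbb_lift1 hfQ) fmapM.
  rewrite -compmA compmA pullback_connection1 -compmA (hc_lift hH) !compmA.
  congr (_ \; _); apply: TfxfE_natural; first exact: tzero_natural.
  exact: (ipbb_lift1 hfQ).
Qed.

End PullbackConnection.

Theorem proposition4p10 (C : category) (TC : tangent_structure C)
    (E M X : C) (q : hom E M) (Q : differential_bundle TC q)
    (H : hom (db_TxE Q) (tT TC E)) (hH : is_horizontal_connection H)
    (f : hom X M) (P : tpullback TC f q)
    (fQ : differential_bundle TC (pb0 P)) (hfQ : is_pullback_bundle Q fQ) :
  exists fH : hom (db_TxE fQ) (tT TC P),
    unique (fun K : hom (db_TxE fQ) (tT TC P) =>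
        K \; fmap (tT TC) (pb1 P) = TfxfE Q fQ \; H
        /\ K \; fmap (tT TC) (pb0 P) = pb0 (db_TxE fQ)) fH
    /\ is_horizontal_connection fH.
Proof.
exists (pullback_connection fQ hH); split; first split.
- by split; [exact: pullback_connection1 | exact: pullback_connection0].
- move=> K [K1 K0]; apply: tpb_ext_T.
  + by rewrite K0 pullback_connection0.
  + by rewrite K1 pullback_connection1.
- split.
  + exact: pullback_connection0.
  + exact: pullback_connection_p.
  + exact: pullback_connection_ell.
  + exact: pullback_connection_lift.
Qed.
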